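(* Let $(\Phi,\Psi)$ be a $\delta$-interleaving pair between persistence modules $V$ and $W$, where $0\le\delta<\frac12\min(\Xi(V),\Xi(W))$. For any pair of bars $J_V\in\mathbf{Bar}(V)$ and $J_W\in\mathbf{Bar}(W)$ satisfying $|J_V|,|J_W|\ge 2\delta$, and for any $\mu\in\mathbb{N}$, the following statements are equivalent: - $(\mathbf{R}_{J_W(\delta)}^{J_V})^{\mu}$ appears in the ladder decomposition of $\Phi$; - $(\mathbf{R}_{J_V(\delta)}^{J_W})^{\mu}$ appears in the ladder decomposition of $\Psi$.
   Context: Fix a field $\mathbb{F}$. A persistence module $V$ is a functor from $(\mathbb{R},\le)$ to $\mathbb{F}$-vector spaces, with inner morphisms $v_{s,t}\colon V_s\to V_t$ for $s\le t$, that is isomorphic to a finite direct sum of interval modules $k_J$, where $J=[i,j]$, $i\le j$, is a closed bounded interval and $k_J$ is $\mathbb{F}$ at indices in $J$, $0$ elsewhere, with identity inner morphisms inside $J$. The multiset of intervals in this decomposition is the barcode $\mathbf{Bar}(V)$; its elements are bars. The length of $J=[i,j]$ is $|J|=j-i$. A morphism $\Phi\colon V\to W$ is a family of linear maps $\Phi_t\colon V_t\to W_t$ commuting with inner morphisms. The shift $V(\delta)$ is given by $V(\delta)_t=V_{t+\delta}$, $v(\delta)_{s,t}=v_{s+\delta,t+\delta}$; correspondingly, for a bar $J=[i,j]$ put $J(\delta)=[i-\delta,j-\delta]$. A $\delta$-interleaving pair between $V$ and $W$ is a pair of morphisms $\Phi\colon V\to W(\delta)$, $\Psi\colon W\to V(\delta)$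 with $\Psi_{t+\delta}\circ\Phi_t=v_{t,t+2\delta}$ and $\Phi_{t+\delta}\circ\Psi_t=w_{t,t+2\delta}$ for all $t$. Relations on intervals: $[i_1,j_1]\preceq[i_2,j_2]$ iff $i_1\le i_2\le j_1\le j_2$; $[i_1,j_1]\subset[i_2,j_2]$ (strictly nested) iff $i_2<i_1\le j_1<j_2$. Nestedness: $\Xi(V)=\min\{\min(|a-c|,|b-d|) : [a,b]\subset[c,d],\ [a,b],[c,d]\in\mathbf{Bar}(V)\}\in(0,\infty]$, equal to $\infty$ if there are no strictly nested bars. A ladder persistence module is a triple $(V,W,\Phi)$ with $\Phi\colon V\to W$ a morphism; isomorphisms are pairs of isomorphisms of the domains and codomains commuting with the morphisms; direct sums are componentwise. For $J_1\preceq J_2$, $\mathbf{R}_{J_1}^{J_2}=(k_{J_2},k_{J_1},\rho)$ with $\rho_t=\mathrm{id}$ for $t\in J_1\cap J_2$ and $0$ otherwise; $\mathbf{I}^+_J=(k_J,0,0)$; $\mathbf{I}^-_K=(0,k_K,0)$. A ladder decomposition of a morphism is an isomorphism of the corresponding triple with a finite direct sum of such elementary modules; its multiplicities are uniquely determined. For a $\delta$-interleaving pair with $\delta<\frac12\min(\Xi(V),\Xi(W))$ ladder decompositions of $(V,W(\delta),\Phi)$ and $(W,V(\delta),\Psi)$ exist. ''$(\mathbf{R}_{J_1}^{J_2})^\mu$ appears in the ladder decomposition'' means that $\mathbf{R}_{J_1}^{J_2}$ occurs in it with multiplicity $\mu$ (multiplicity $0$ if not $J_1\preceq J_2$). *)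

(* Defs.v *)
From HB Require Import structures.
From mathcomp Require Import all_boot all_order all_algebra.
From mathcomp Require Import reals constructive_ereal.

Set Implicit Arguments.
Unset Strict Implicit.
Unset Printing Implicit Defensive.

Import Order.TTheory GRing.Theory Num.Theory.
Local Open Scope ring_scope.
#[local] Obligation Tactic := idtac.

Section Bars.
Variable R : realType.

Record bar := Bar { ends : R * R; _ : ends.1 <= ends.2 }.

HB.instance Definition _ := [isSub for ends].
HB.instance Definition _ := [Choice of bar by <:].

Definition lo (J : bar) : R := (ends J).1.
Definition hi (J : bar) : R := (ends J).2.

Lemma lo_le_hi (J : bar) : lo J <= hi J.
Proof. by case: J. Qed.

Definition in_bar (t : R) (J : bar) : bool := t \in `[lo J, hi J].

Definition blen (J : bar) : R := hi J - lo J.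

Lemma bshift_subproof (J : bar) (d : R) : (lo J - d, hi J - d).1 <= (lo J - d, hi J - d).2.
Proof. by rewrite /= lerD2r lo_le_hi. Qed.

Definition bshift (J : bar) (d : R) : bar := Bar (bshift_subproof J d).

Definition bprec (J1 J2 : bar) : bool :=
  [&& lo J1 <= lo J2, lo J2 <= hi J1 & hi J1 <= hi J2].

(* The middle inequality [lo J1 <= hi J1] holds for every bar. *)
Definition bnested (J1 J2 : bar) : bool := (lo J2 < lo J1) && (hi J1 < hi J2).

(* A barcode is a multiset of bars, represented by a sequence whose order is
   irrelevant. *)
Definition nestedness (B : seq bar) : \bar R :=
  \big[Order.min/+oo%E]_(J <- B) \big[Order.min/+oo%E]_(K <- B | bnested J K)
    (Num.min `|lo J - lo K| `|hi J - hi K|)%:E.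

End Bars.

Section PersistenceModules.
Variables (R : realType) (F : fieldType).

Record pmod := PMod {
  pm_at :> R -> lmodType F;
  inner : forall s t : R, s <= t -> {linear pm_at s -> pm_at t};
  inner_id : forall (t : R) (h : t <= t) x, inner h x = x;
  inner_comp : forall (s t u : R) (hst : s <= t) (htu : t <= u) (hsu : s <= u) x,
    inner htu (inner hst x) = inner hsu x }.

Record pmor (V W : pmod) := PMor {
  pm_app :> forall t : R, {linear V t -> W t};
  pm_natural : forall (s t : R) (h : s <= t) x,
    pm_app t (inner V h x) = inner W h (pm_app s x) }.

Definition mutually_inverse (V W : pmod) (f : pmor V W) (g : pmor W V) : Prop :=
  (forall t, cancel (f t) (g t)) /\ (forall t, cancel (g t) (f t)).

Definition pmod_iso (V W : pmod) : Prop :=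
  exists (f : pmor V W) (g : pmor W V), mutually_inverse f g.

Program Definition shift (V : pmod) (d : R) : pmod :=
  @PMod (fun t => V (t + d))
    (fun s t (h : s <= t) => inner V (etrans (lerD2r d s t) h)) _ _.
Next Obligation. by move=> V d t h x; exact: inner_id. Qed.
Next Obligation. by move=> V d s t u hst htu hsu x; exact: inner_comp. Qed.

Program Definition pmor0 (V W : pmod) : pmor V W :=
  @PMor V W (fun t => \0 : {linear V t -> W t}) _.
Next Obligation. by move=> V W s t h x /=; rewrite linear0. Qed.

Lemma le_add2 (d : R) (hd : 0 <= d) (t : R) : t <= t + d + d.
Proof. by rewrite -addrA lerDl addr_ge0. Qed.

(* [t + 2 delta] is written [t + delta + delta], which is the index at which
   [Psi (t + delta)] and [Phi (t + delta)] take their values. *)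
Definition interleaving (V W : pmod) (delta : R) (hd : 0 <= delta)
    (Phi : pmor V (shift W delta)) (Psi : pmor W (shift V delta)) : Prop :=
  (forall (t : R) (x : V t), Psi (t + delta) (Phi t x) = inner V (le_add2 hd t) x)
  /\ (forall (t : R) (y : W t), Phi (t + delta) (Psi t y) = inner W (le_add2 hd t) y).

(* For [b : bool], ['rV[F]_b] is F if [b] holds and the zero space otherwise;
   [unit_map b c] is the identity of F if [b] and [c] both hold, and 0 if not. *)
Definition unit_map (b c : bool) : {linear 'rV[F]_b -> 'rV[F]_c} :=
  mulmxr (const_mx 1).

Lemma unit_map_id (b : bool) (x : 'rV[F]_b) : unit_map b b x = x.
Proof.
apply/rowP=> i; rewrite !mxE; case: b x i => x i; last by case: i.
by rewrite big_ord1 !mxE mulr1 (ord1 i).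
Qed.

Lemma unit_map_comp (b c d : bool) (x : 'rV[F]_b) :
  (b && d ==> c) -> unit_map c d (unit_map b c x) = unit_map b d x.
Proof.
case: b c d x => [] [] [] x //= _; rewrite -mulmxA; congr (_ *m _);
  apply/matrixP=> i j; rewrite !mxE; do ?[by case: i | by case: j].
by rewrite big_ord1 !mxE mulr1.
Qed.

Program Definition interval_module (J : bar R) : pmod :=
  @PMod (fun t => 'rV[F]_(in_bar t J))
    (fun s t _ => unit_map (in_bar s J) (in_bar t J)) _ _.
Next Obligation. by move=> J t h x; exact: unit_map_id. Qed.
Next Obligation.
move=> J s t u hst htu hsu x; apply: unit_map_comp; rewrite /in_bar !in_itv /=.
apply/implyP=> /andP[/andP[h1 _] /andP[_ h2]].
by rewrite (le_trans h1 hst) (le_trans htu h2).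
Qed.

Program Definition pmod0 : pmod := @PMod (fun=> 'rV[F]_0) (fun s t _ => idfun) _ _.
Next Obligation. by []. Qed.
Next Obligation. by []. Qed.

Section PairMap.
Variables (A B C D : lmodType F) (f : {linear A -> C}) (g : {linear B -> D}).

Definition pair_map (x : A * B) : C * D := (f x.1, g x.2).

Lemma pair_map_linear : linear pair_map.
Proof. by move=> a x y; rewrite /pair_map /= !linearP. Qed.

HB.instance Definition _ :=
  GRing.isLinear.Build F (A * B)%type (C * D)%type _ pair_map pair_map_linear.

End PairMap.

Program Definition pmod_add (V W : pmod) : pmod :=
  @PMod (fun t => (V t * W t)%type : lmodType F)
    (fun s t h => pair_map (inner V h) (inner W h)) _ _.
Next Obligation. by move=> V W t h [x y]; rewrite /= /pair_map /= !inner_id. Qed.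
Next Obligation.
move=> V W s t u hst htu hsu [x y].
by rewrite /= /pair_map /= !(inner_comp hst htu hsu).
Qed.

Program Definition pmor_add (V V' W W' : pmod) (f : pmor V W) (g : pmor V' W') :
    pmor (pmod_add V V') (pmod_add W W') :=
  @PMor (pmod_add V V') (pmod_add W W') (fun t => pair_map (f t) (g t)) _.
Next Obligation.
by move=> V V' W W' f g s t h [x y]; rewrite /= /pair_map /= !pm_natural.
Qed.

(* [V] decomposes with barcode [B], i.e. Bar(V) = B up to reordering. *)
Definition is_barcode (V : pmod) (B : seq (bar R)) : Prop :=
  pmod_iso V (foldr pmod_add pmod0 (map interval_module B)).

Record ladder := Ladder { ldom : pmod; lcod : pmod; lmor : pmor ldom lcod }.

Definition ladder_iso (L M : ladder) : Prop :=
  exists (f : pmor (ldom L) (ldom M)) (f' : pmor (ldom M) (ldom L))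
         (g : pmor (lcod L) (lcod M)) (g' : pmor (lcod M) (lcod L)),
    [/\ mutually_inverse f f', mutually_inverse g g'
      & forall t x, g t (lmor L t x) = lmor M t (f t x)].

Definition ladder0 : ladder := Ladder (pmor0 pmod0 pmod0).

Definition ladder_add (L M : ladder) : ladder := Ladder (pmor_add (lmor L) (lmor M)).

Program Definition overlap_map (J1 J2 : bar R) (h : bprec J1 J2) :
    pmor (interval_module J2) (interval_module J1) :=
  @PMor (interval_module J2) (interval_module J1)
    (fun t => unit_map (in_bar t J2) (in_bar t J1)) _.
Next Obligation.
move=> J1 J2 /andP[h1 /andP[_ h2]] s t hst x.
have key : in_bar s J2 && in_bar t J1 ==> in_bar t J2 && in_bar s J1.
  rewrite /in_bar !in_itv /=; apply/implyP=> /andP[/andP[a b] /andP[c d]].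
  by rewrite (le_trans a hst) (le_trans d h2) (le_trans h1 a) (le_trans hst d).
rewrite /= -/(unit_map _ _ _).
transitivity (unit_map (in_bar s J2) (in_bar t J1) x).
  by apply: unit_map_comp; apply/implyP=> /(implyP key)/andP[].
by apply/esym/unit_map_comp; apply/implyP=> /(implyP key)/andP[].
Qed.

(* [ElR h] with [h : bprec J1 J2] is R_{J1}^{J2} (lower index first); [ElIplus J]
   is I^+_J and [ElIminus K] is I^-_K. *)
Inductive elementary :=
| ElR (J1 J2 : bar R) of bprec J1 J2
| ElIplus of bar R
| ElIminus of bar R.

Definition elementary_ladder (e : elementary) : ladder :=
  match e with
  | ElR J1 J2 h => Ladder (overlap_map h)
  | ElIplus J => Ladder (pmor0 (interval_module J) pmod0)
  | ElIminus K => Ladder (pmor0 pmod0 (interval_module K))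
  end.

Definition ladder_decomposition (V W : pmod) (Phi : pmor V W) (D : seq elementary) : Prop :=
  ladder_iso (Ladder Phi) (foldr ladder_add ladder0 (map elementary_ladder D)).

Definition is_ElR (J1 J2 : bar R) (e : elementary) : bool :=
  if e is ElR K1 K2 _ then (K1 == J1) && (K2 == J2) else false.

(* R_{J1}^{J2} occurs in [D] with multiplicity [mu]; in particular [mu] = 0 when
   not [bprec J1 J2]. *)
Definition appears_R (D : seq elementary) (J1 J2 : bar R) (mu : nat) : Prop :=
  count (is_ElR J1 J2) D = mu.

End PersistenceModules.

(* Main.v *)
Require Import Defs.
From HB Require Import structures.
From mathcomp Require Import all_boot all_order all_algebra.
From mathcomp Require Import reals constructive_ereal.
From mathcomp Require Import lra.

(* Put JV = [c, d], JW = [a, b] and suppose R_{JW(delta)}^{JV} occurs n times in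
   Phi, with generators e_i in V_c and f_i in W_a, so that Phi(e_i) is the image
   of f_i.  Applying Psi shows that c <= a + delta, d <= b + delta and that
   Psi(f_i) = e_i + z_i, where e_i stands for its image in V_{a + delta} and z_i
   dies by time c + 2 delta <= d; the nestedness bound forces z_i to be born by
   time c.  Hence f_i satisfies the birth and death conditions attached to
   R_{JV(delta)}^{JW} in Psi.  The functional sending y in W_a to the coefficient
   of Psi(y) on e_i is also the coefficient of Phi(Psi(y)) = w(y) on f_i, so it
   vanishes whenever one of these four conditions holds strictly.  As these
   functionals are dual to the f_i, R_{JV(delta)}^{JW} occurs at least n times in
   Psi, and equality follows by exchanging V and W. *)

Set Implicit Arguments.
Unset Strict Implicit.
Unset Printing Implicit Defensive.

Import Order.TTheory GRing.Theory Num.Theory.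
Local Open Scope ring_scope.

(** * Copies of [R_{J1}^{J2}] split off from a ladder decomposition *)

Section Retractions.
Variables (R : realType) (F : fieldType).
Implicit Types (L M : ladder R F) (J K : bar R).

Lemma unit_map_inj (b c : bool) (x : 'rV[F]_b) :
  (b ==> c) -> unit_map F b c x = 0 -> x = 0.
Proof.
move=> bc x0; rewrite -[x]unit_map_id -(@unit_map_comp _ b c b) ?x0 ?linear0 //.
by case: b c bc {x x0} => [] [].
Qed.

Lemma rV_false (x : 'rV[F]_false) : x = 0.
Proof. exact: thinmx0. Qed.

Lemma interval_neq0 J s (x : interval_module F J s) : x != 0 -> lo J <= s <= hi J.
Proof.
rewrite -[_ <= s <= _]/(in_bar s J); apply: contra_neqT => /negbTE sJ.
by move: x; rewrite /= sJ => x; exact: rV_false.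
Qed.

Lemma interval_inner_neq0 J s t (hst : s <= t) (x : interval_module F J s) :
  x != 0 -> t <= hi J -> inner (interval_module F J) hst x != 0.
Proof.
move=> x0 tJ; apply: contra_neq x0; apply: unit_map_inj.
rewrite /in_bar !in_itv /= tJ andbT.
by apply/implyP => /andP[? _]; apply: le_trans hst.
Qed.

Lemma interval_lift J s t (hst : s <= t) (x : interval_module F J t) :
  lo J <= s -> exists z, x = inner (interval_module F J) hst z.
Proof.
(* The preimage comes from [unit_map] run backwards in time: going back to [s] and forth again is
   the identity at [t], because [s] lies in [J] whenever [t] does. *)
move=> sJ; exists (unit_map F (in_bar t J) (in_bar s J) x).
rewrite -[LHS]unit_map_id.
apply/esym/(@unit_map_comp F (in_bar t J) (in_bar s J) (in_bar t J)).
rewrite andbb /in_bar !in_itv /= sJ /=; apply/implyP => /andP[_].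
exact: le_trans.
Qed.

(* [E], [G] embed n copies of [R_{J1}^{J2}] in [L], by their values on the
   generators at the birth times, and [P], [Q] read off the coordinates in
   these copies. *)
Record retraction L J1 J2 (n : nat)
    (E : 'rV[F]_n -> ldom L (lo J2)) (G : 'rV[F]_n -> lcod L (lo J1))
    (P : forall t, ldom L t -> 'rV[F]_n) (Q : forall t, lcod L t -> 'rV[F]_n) : Prop :=
  Retraction {
    retr_linG : linear G;
    retr_linP : forall t, linear (P t);
    retr_gen : forall (h : lo J1 <= lo J2) x,
      lmor L (lo J2) (E x) = inner (lcod L) h (G x);
    retr_Edies : forall t (h : lo J2 <= t) x, hi J2 < t -> inner (ldom L) h (E x) = 0;
    retr_Gdies : forall t (h : lo J1 <= t) x, hi J1 < t -> inner (lcod L) h (G x) = 0;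
    retr_PE : forall t (h : lo J2 <= t) x, t <= hi J2 -> P t (inner (ldom L) h (E x)) = x;
    retr_Pborn : forall s t (h : s <= t) x, s < lo J2 -> P t (inner (ldom L) h x) = 0;
    retr_Pker : forall t (h : t <= hi J2) x, inner (ldom L) h x = 0 -> P t x = 0;
    retr_Qborn : forall s t (h : s <= t) x, s < lo J1 -> Q t (inner (lcod L) h x) = 0;
    retr_Qker : forall t (h : t <= hi J1) x, inner (lcod L) h x = 0 -> Q t x = 0;
    retr_QP : forall t x, lo J2 <= t -> t <= hi J1 -> Q t (lmor L t x) = P t x }.

Definition has_retraction L J1 J2 (n : nat) : Prop :=
  exists E G P Q, @retraction L J1 J2 n E G P Q.

Lemma has_retraction0 L J1 J2 : has_retraction L J1 J2 0.
Proof.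
exists (fun=> 0), (fun=> 0), (fun _ _ => 0), (fun _ _ => 0).
split=> //; first by move=> k x y; rewrite scaler0 addr0.
- by move=> t k x y; rewrite scaler0 addr0.
- by move=> *; rewrite !linear0.
- by move=> *; rewrite linear0.
- by move=> *; rewrite linear0.
- by move=> t h x _; rewrite [RHS]thinmx0.
Qed.

Lemma has_retraction_add L M J1 J2 n m :
  has_retraction L J1 J2 n -> has_retraction M J1 J2 m ->
  has_retraction (ladder_add L M) J1 J2 (n + m).
Proof.
move=> [E [G [P [Q r]]]] [E' [G' [P' [Q' r']]]].
exists (fun x => (E (lsubmx x), E' (rsubmx x))), (fun x => (G (lsubmx x), G' (rsubmx x))),
  (fun t x => row_mx (P t x.1) (P' t x.2)), (fun t x => row_mx (Q t x.1) (Q' t x.2)).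
split.
- by move=> k x y; rewrite !linearP (retr_linG r) (retr_linG r').
- move=> t k x y.
  by rewrite (retr_linP r) (retr_linP r') scale_row_mx add_row_mx.
- by move=> h x; congr pair; [exact: (retr_gen r) | exact: (retr_gen r')].
- by move=> t h x ht; congr pair; [exact: (retr_Edies r) | exact: (retr_Edies r')].
- by move=> t h x ht; congr pair; [exact: (retr_Gdies r) | exact: (retr_Gdies r')].
- by move=> t h x ht /=; rewrite (retr_PE r) // (retr_PE r') // hsubmxK.
- by move=> s t h x hs /=; rewrite (retr_Pborn r) // (retr_Pborn r') // row_mx0.
- move=> t h x /= [x1 x2].
  by rewrite (retr_Pker r x1) (retr_Pker r' x2) row_mx0.
- by move=> s t h x hs /=; rewrite (retr_Qborn r) // (retr_Qborn r') // row_mx0.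
- move=> t h x /= [x1 x2].
  by rewrite (retr_Qker r x1) (retr_Qker r' x2) row_mx0.
- by move=> t x h1 h2 /=; rewrite (retr_QP r) // (retr_QP r').
Qed.

Lemma has_retraction_iso L M J1 J2 n :
  ladder_iso L M -> has_retraction M J1 J2 n -> has_retraction L J1 J2 n.
Proof.
move=> [f [f' [g [g' [[ff' f'f] [gg' g'g] fg]]]]] [E [G [P [Q r]]]].
exists (fun x => f' _ (E x)), (fun x => g' _ (G x)),
  (fun t x => P t (f t x)), (fun t x => Q t (g t x)).
split.
- by move=> k x y; rewrite (retr_linG r) linearP.
- by move=> t k x y; rewrite linearP (retr_linP r).
- move=> h x; apply: (can_inj (gg' _)).
  by rewrite fg f'f (retr_gen r h) -[in RHS]pm_natural g'g.
- by move=> t h x ht; rewrite -pm_natural (retr_Edies r) // linear0.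
- by move=> t h x ht; rewrite -pm_natural (retr_Gdies r) // linear0.
- by move=> t h x ht; rewrite pm_natural f'f (retr_PE r).
- by move=> s t h x hs; rewrite pm_natural (retr_Pborn r).
- by move=> t h x x0; apply: (retr_Pker r (h := h)); rewrite -pm_natural x0 linear0.
- by move=> s t h x hs; rewrite pm_natural (retr_Qborn r).
- by move=> t h x x0; apply: (retr_Qker r (h := h)); rewrite -pm_natural x0 linear0.
- by move=> t x h1 h2; rewrite fg (retr_QP r).
Qed.

Lemma has_retraction_ElR J1 J2 (h : bprec J1 J2) :
  has_retraction (elementary_ladder F (ElR h)) J1 J2 1.
Proof.
have /and3P[h1 h2 h3] := h.
(* [true] coerces to 1, so ['rV[F]_true] is the coordinate space of a single copy. *)
exists (unit_map F true _), (unit_map F true _),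
  (fun t => unit_map F (in_bar t J2) true), (fun t => unit_map F (in_bar t J1) true).
have dead J (t : R) (x : 'rV[F]_(in_bar t J)) : t < lo J \/ hi J < t -> x = 0.
  by move=> ht; apply/eqP; apply: contraPT ht => /interval_neq0/andP[? ?]; case; lra.
have live J (t : R) : lo J <= t -> t <= hi J -> in_bar t J.
  by rewrite /in_bar in_itv /= => -> ->.
split.
- by move=> k x y; rewrite linearP.
- by move=> t k x y; rewrite linearP.
- move=> h' x.
  transitivity (unit_map F true (in_bar (lo J2) J1) x).
    by apply: unit_map_comp; rewrite [in_bar _ J2]live ?lexx ?lo_le_hi ?implybT.
  by apply/esym/unit_map_comp; rewrite [in_bar (lo J1) J1]live ?lexx ?lo_le_hi ?implybT.
- by move=> t ht x dt; apply: dead; right.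
- by move=> t ht x dt; apply: dead; right.
- move=> t ht x dt.
  transitivity (unit_map F (in_bar t J2) true (unit_map F true (in_bar t J2) x)).
    apply: (congr1 (unit_map F (in_bar t J2) true)); apply: unit_map_comp.
    by rewrite [in_bar (lo J2) J2]live ?lexx ?lo_le_hi ?implybT.
  by rewrite unit_map_comp ?unit_map_id // live.
- by move=> s t ht x hs; rewrite (dead _ _ x) ?linear0 //; left.
- move=> t ht x x0; rewrite (unit_map_inj _ x0) ?linear0 //.
  by rewrite /in_bar !in_itv /= lo_le_hi lexx andbT; apply/implyP => /andP[].
- by move=> s t ht x hs; rewrite (dead _ _ x) ?linear0 //; left.
- move=> t ht x x0; rewrite (unit_map_inj _ x0) ?linear0 //.
  by rewrite /in_bar !in_itv /= lo_le_hi lexx andbT; apply/implyP => /andP[].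
- move=> t x ht dt; apply: (@unit_map_comp F (in_bar t J2) (in_bar t J1) true).
  by rewrite [in_bar t J1]live ?implybT // (le_trans h1).
Qed.

(** Retractions add up over direct sums: each copy of [R_{J1}^{J2}] contributes one coordinate,
    every other summand the empty retraction. *)
Lemma has_retraction_decomposition (V W : pmod R F) (Phi : pmor V W) D J1 J2 :
  ladder_decomposition Phi D ->
  has_retraction (Ladder Phi) J1 J2 (count (is_ElR J1 J2) D).
Proof.
move=> /has_retraction_iso; apply; elim: D => [|e D IH]; first exact: has_retraction0.
apply: has_retraction_add IH; case: e => [K1 K2 h|J|K] /=; try exact: has_retraction0.
case: eqP => [<-|_] /=; last exact: has_retraction0.
case: eqP => [<-|_] /=; last exact: has_retraction0.
exact: has_retraction_ElR.
Qed.

End Retractions.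

(** * Bounding a multiplicity from below by the rank of a pairing *)

Section RankBound.
Variables (R : realType) (F : fieldType) (J1 J2 : bar R).
Implicit Types (L M : ladder R F).

(** Together with [blind] this isolates the summands [R_{J1}^{J2}]. Candidates have no component on
    bars that end too late, nor an image on codomain bars that start too late; [blind] maps ignore
    whatever starts or ends too early. *)
Definition candidate L (y : ldom L (lo J2)) : Prop :=
  [/\ forall t (h : lo J2 <= t), hi J2 < t -> inner (ldom L) h y = 0,
      forall h : lo J1 <= lo J2, exists z, lmor L _ y = inner (lcod L) h z
    & forall t (h : lo J2 <= t), hi J1 < t -> inner (lcod L) h (lmor L _ y) = 0].

Record blind L m (Lam : ldom L (lo J2) -> 'rV[F]_m) : Prop := Blind {
  blind_born : forall s (h : s <= lo J2) x, s < lo J2 -> Lam (inner (ldom L) h x) = 0;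
  blind_dies : forall x, inner (ldom L) (lo_le_hi J2) x = 0 -> Lam x = 0;
  blind_cod_born : forall x s (h : s <= lo J2) z, s < lo J1 ->
    lmor L _ x = inner (lcod L) h z -> Lam x = 0;
  blind_cod_dies : forall x (h : lo J2 <= hi J1),
    inner (lcod L) h (lmor L _ x) = 0 -> Lam x = 0 }.

(* The multiplicity of [R_{J1}^{J2}] is the dimension of the space of candidates
   modulo the common kernel of the blind maps; pairing the two families bounds
   it from below by a rank. *)
Definition mult_le L (k : nat) : Prop :=
  forall n m (Y : 'rV[F]_n -> ldom L (lo J2)) (Lam : ldom L (lo J2) -> 'rV[F]_m)
    (A : 'M[F]_(n, m)),
  linear Y -> linear Lam -> (forall x, candidate (Y x)) -> blind Lam ->
  (forall x, x *m A = Lam (Y x)) -> (\rank A <= k)%N.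

Lemma linear_mx n m (f : 'rV[F]_n -> 'rV[F]_m) :
  linear f -> exists A : 'M[F]_(n, m), forall x, x *m A = f x.
Proof.
move=> lf; pose g := GRing.isLinear.Build F _ _ _ f lf.
pose f' : {linear 'rV[F]_n -> 'rV[F]_m} := HB.pack f g.
by exists (lin1_mx f') => x; rewrite mul_rV_lin1.
Qed.

Lemma mult_le_iso L M k : ladder_iso L M -> mult_le M k -> mult_le L k.
Proof.
move=> [f [f' [g [g' [[ff' f'f] [gg' g'g] fg]]]]] Mk n m Y Lam A lY lLam candY bLam AE.
have fg' t x : g' t (lmor M t x) = lmor L t (f' t x).
  by apply: (can_inj (gg' _)); rewrite fg f'f g'g.
apply: (Mk n m (fun x => f _ (Y x)) (fun y => Lam (f' _ y)) A).
- by move=> k' x y; rewrite lY linearP.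
- by move=> k' x y; rewrite linearP lLam.
- move=> x; have [c1 c2 c3] := candY x; split.
  + by move=> t h ht; rewrite -pm_natural c1 // linear0.
  + by move=> h; have [z zE] := c2 h; exists (g _ z); rewrite -fg zE pm_natural.
  + by move=> t h ht; rewrite -fg -pm_natural c3 // linear0.
- split.
  + by move=> s h x hs; rewrite pm_natural (blind_born bLam).
  + by move=> x x0; apply: (blind_dies bLam); rewrite -pm_natural x0 linear0.
  + move=> x s h z hs e; apply: (blind_cod_born bLam (h := h) (z := g' _ z) hs).
    by rewrite -fg' e pm_natural.
  + move=> x h x0; apply: (blind_cod_dies bLam (h := h)).
    by rewrite -fg' -pm_natural x0 linear0.
- by move=> x; rewrite AE ff'.
Qed.

(** Restricting [Lam] to the two summands and projecting [Y] onto them writes [A] as a sum of two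
    pairing matrices, and rank is subadditive. *)
Lemma mult_le_add L M k l :
  mult_le L k -> mult_le M l -> mult_le (ladder_add L M) (k + l).
Proof.
move=> Lk Ml n m Y Lam A lY lLam candY bLam AE.
pose Lam1 x := Lam (x, 0); pose Lam2 x := Lam (0, x).
have l1 : linear (fun x => (Y x).1) by move=> c x y; rewrite lY.
have l2 : linear (fun x => (Y x).2) by move=> c x y; rewrite lY.
have lL1 : linear Lam1.
  move=> c x y; rewrite /Lam1 -lLam; congr Lam.
  by congr pair; rewrite /= scaler0 addr0.
have lL2 : linear Lam2.
  move=> c x y; rewrite /Lam2 -lLam; congr Lam.
  by congr pair; rewrite /= scaler0 addr0.
have [|A1 A1E] := @linear_mx n m (fun x => Lam1 (Y x).1).
  by move=> c x y; rewrite l1 lL1.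
have [|A2 A2E] := @linear_mx n m (fun x => Lam2 (Y x).2).
  by move=> c x y; rewrite l2 lL2.
have -> : A = A1 + A2.
  apply/row_matrixP => i; rewrite !rowE mulmxDr AE A1E A2E /Lam1 /Lam2.
  rewrite -[X in X + _]scale1r -lLam; congr Lam.
  by case: (Y _) => y1 y2; congr pair; rewrite scale1r ?addr0 ?add0r.
apply: leq_trans (mxrank_add _ _) (leq_add _ _).
- apply: (Lk n m _ Lam1 A1 l1 lL1 _ _ A1E).
    move=> x; have [c1 c2 c3] := candY x; split.
    + by move=> t h ht; have [] := c1 t h ht.
    + by move=> h; have [z [zE _]] := c2 h; exists z.1.
    + by move=> t h ht; have [] := c3 t h ht.
  split.
  + move=> s h x hs; rewrite -(blind_born bLam h (x, 0) hs).
    by congr Lam; congr pair; rewrite linear0.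
  + move=> x x0; apply: (blind_dies bLam).
    by rewrite /= /pair_map /= x0 linear0.
  + move=> x s h z hs e; apply: (blind_cod_born bLam (h := h) (z := (z, 0)) hs).
    by rewrite /= /pair_map /= e !linear0.
  + move=> x h x0; apply: (blind_cod_dies bLam (h := h)).
    by rewrite /= /pair_map /= x0 !linear0.
- apply: (Ml n m _ Lam2 A2 l2 lL2 _ _ A2E).
    move=> x; have [c1 c2 c3] := candY x; split.
    + by move=> t h ht; have [] := c1 t h ht.
    + by move=> h; have [z [_ zE]] := c2 h; exists z.2.
    + by move=> t h ht; have [] := c3 t h ht.
  split.
  + move=> s h x hs; rewrite -(blind_born bLam h (0, x) hs).
    by congr Lam; congr pair; rewrite linear0.
  + move=> x x0; apply: (blind_dies bLam).
    by rewrite /= /pair_map /= x0 linear0.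
  + move=> x s h z hs e; apply: (blind_cod_born bLam (h := h) (z := (0, z)) hs).
    by rewrite /= /pair_map /= e !linear0.
  + move=> x h x0; apply: (blind_cod_dies bLam (h := h)).
    by rewrite /= /pair_map /= x0 !linear0.
Qed.

Lemma mult_le0 L : (forall m (Lam : ldom L (lo J2) -> 'rV[F]_m), linear Lam -> blind Lam ->
  forall y, candidate y -> Lam y = 0) -> mult_le L 0.
Proof.
move=> L0 n m Y Lam A lY lLam candY bLam AE; rewrite leqn0 mxrank_eq0.
by apply/eqP/row_matrixP => i; rewrite rowE AE L0 // row0.
Qed.

Lemma linear_at0 (A B : lmodType F) (f : A -> B) : linear f -> f 0 = 0.
Proof. by move=> lf; have := lf (-1) 0 0; rewrite scaler0 addr0 scaleN1r addNr. Qed.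

(** Some endpoint of [K1] or [K2] differs from that of [J1] or [J2]. The proof compares them one by
    one: if it is too early, [blind] gives [Lam y = 0]; if it is too late, [candidate] contradicts
    that [y] or its image is nonzero. *)
Lemma mult_le_ElR_neq K1 K2 (h : bprec K1 K2) :
  bprec J1 J2 -> (K1 == J1) && (K2 == J2) = false ->
  mult_le (elementary_ladder F (ElR h)) 0.
Proof.
move=> /and3P[h1 h2 h3] neq; apply: mult_le0 => m Lam lLam bLam y [c1 c2 c3].
have [->|y0] := eqVneq y 0; first exact: linear_at0.
have /andP[ly uy] := interval_neq0 y0.
have [born|] := ltP (lo K2) (lo J2).
  have [z ->] := interval_lift ly y (lexx _).
  exact: (blind_born bLam).
move=> /(conj ly)/andP/le_anti lK2.
have [dies|] := ltP (hi K2) (hi J2).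
  apply: (blind_dies bLam); apply/eqP/contraT => /interval_neq0.
  by rewrite [hi _ <= hi _]leNgt dies andbF.
rewrite le_eqVlt => /orP[/eqP hK2|late]; last first.
  by have := interval_inner_neq0 uy y0 (lexx _); rewrite (c1 _ uy late) eqxx.
pose x := lmor (elementary_ladder F (ElR h)) _ y.
have [x0|x0] := eqVneq x 0.
  by apply: (blind_cod_dies bLam (h := h2)); rewrite -/x x0 linear0.
have /andP[lx ux] := interval_neq0 x0.
have [dies|] := ltP (hi K1) (hi J1).
  apply: (blind_cod_dies bLam (h := h2)); apply/eqP/contraT => /interval_neq0.
  by rewrite [hi _ <= hi _]leNgt dies andbF.
rewrite le_eqVlt => /orP[/eqP hK1|late]; last first.
  by have := interval_inner_neq0 ux x0 (lexx _); rewrite (c3 _ ux late) eqxx.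
have [born|] := ltP (lo K1) (lo J1).
  have [z xE] := interval_lift lx x (lexx _).
  exact: (blind_cod_born bLam born xE).
rewrite le_eqVlt => /orP[/eqP lK1|late].
  case/negP: (negbT neq); apply/andP; split; apply/eqP/val_inj.
    by rewrite /= [ends K1]surjective_pairing [ends J1]surjective_pairing; congr pair.
  by rewrite /= [ends K2]surjective_pairing [ends J2]surjective_pairing; congr pair.
(* The image of [y] would come from index [lo J1], where the bar [K1] is not yet born. *)
have [z xE] := c2 h1.
have z0 : z = 0.
  apply/eqP/contraT => /interval_neq0.
  by rewrite leNgt late.
by move: x0; rewrite /x xE z0 linear0 eqxx.
Qed.

Lemma mult_le_elementary (e : elementary R) :
  bprec J1 J2 -> mult_le (elementary_ladder F e) (is_ElR J1 J2 e).
Proof.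
move=> hJ; case: e => [K1 K2 h|J|K] /=.
- case neq: (_ && _); last exact: mult_le_ElR_neq.
  (* For the matching summand, [A] factors through the domain at [lo J2], whose dimension is a
     boolean and hence at most 1. *)
  move=> n m Y Lam A lY lLam _ _ AE.
  have [A1 A1E] := linear_mx lY; have [A2 A2E] := linear_mx lLam.
  have -> : A = A1 *m A2.
    by apply/row_matrixP => i; rewrite !rowE mulmxA AE A1E A2E.
  by apply: leq_trans (mulmx_max_rank _ _) _; exact: leq_b1.
- apply: mult_le0 => m Lam lLam bLam y _; have /and3P[_ h _] := hJ.
  by apply: (blind_cod_dies bLam (h := h)).
- apply: mult_le0 => m Lam lLam bLam y _.
  by rewrite (thinmx0 y : y = 0) linear_at0.
Qed.

Lemma mult_le_decomposition (V W : pmod R F) (Phi : pmor V W) D :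
  bprec J1 J2 -> ladder_decomposition Phi D ->
  mult_le (Ladder Phi) (count (is_ElR J1 J2) D).
Proof.
move=> hJ /mult_le_iso; apply; elim: D => [|e D IH] /=.
  apply: mult_le0 => m Lam lLam bLam y _.
  by rewrite (thinmx0 y : y = 0) linear_at0.
by apply: mult_le_add IH; exact: mult_le_elementary.
Qed.

End RankBound.

(** * Consequences of barcodes and reindexing of inner maps *)

Lemma nestedness_gt (R : realType) (B : seq (bar R)) (r : R) (J K : bar R) :
  (r%:E < nestedness B)%E -> J \in B -> K \in B -> bnested J K ->
  r < `|lo J - lo K|.
Proof.
have min_inf (s : seq (bar R)) (P : pred (bar R)) (f : bar R -> \bar R) x :
    x \in s -> P x -> (\big[Order.min/+oo]_(y <- s | P y) f y <= f x)%E.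
  elim: s => [//|y s IH]; rewrite inE big_cons => /orP[/eqP <- Px|xs Px].
    by rewrite Px ge_min lexx.
  by case: ifP => _; rewrite ?ge_min IH // orbT.
move=> rB JB KB JK; rewrite -lte_fin; apply: lt_le_trans rB _.
apply: le_trans (min_inf _ _ _ _ JB isT) _.
apply: le_trans (min_inf _ _ _ _ KB JK) _.
by rewrite lee_fin ge_min lexx.
Qed.

(** Work bar by bar: a component of [x] that vanishes at [t] is either zero or sits on a bar that
    dies before [t], and such a bar is already born at [r], so the component lifts. *)
Lemma barcode_ker_sub_im (R : realType) (F : fieldType) (V : pmod R F) B
    (r s t : R) (hrs : r <= s) (hst : s <= t) (x : V s) :
  is_barcode V B ->
  (forall K, K \in B -> lo K <= s -> s <= hi K -> hi K < t -> lo K <= r) ->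
  inner V hst x = 0 -> exists z, x = inner V hrs z.
Proof.
move=> [f [g [fg gf]]] hB x0.
suff [z zE] : exists z, f s x = inner _ hrs z.
  by exists (g r z); apply: (can_inj (fg _)); rewrite zE -pm_natural gf.
have {x0} : inner _ hst (f s x) = 0 by rewrite -pm_natural x0 linear0.
move: (f s x); elim: B hB {f g fg gf} => [|K B IH] hB y.
  by move=> _; exists 0; rewrite (thinmx0 y : y = 0) linear0.
case: y => y1 y2 [y10 y20].
have [|z2 z2E] := IH _ y2 y20.
  by move=> K' K'B; apply: hB; rewrite inE K'B orbT.
have [z1 z1E] : exists z, y1 = inner (interval_module F K) hrs z.
  have [->|y1_neq0] := eqVneq y1 0; first by exists 0; rewrite linear0.
  have /andP[l u] := interval_neq0 y1_neq0.
  apply: interval_lift; apply: hB; rewrite ?inE ?eqxx // ltNge; apply/negP => tK.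
  by case/eqP: (interval_inner_neq0 hst y1_neq0 tK); exact: y10.
by exists (z1, z2); rewrite z1E z2E.
Qed.

(** This replaces the inequality proof built into [shift] by an arbitrary one, so that [inner_comp]
    can be applied in the unshifted module. *)
Lemma inner_shift (R : realType) (F : fieldType) (V : pmod R F) (d s t : R)
    (h : s <= t) (h' : s + d <= t + d) (x : V (s + d)) :
  inner (shift V d) h x = inner V h' x.
Proof. by rewrite /= (bool_irrelevance (etrans _ _) h'). Qed.

Lemma inner_eq0 (R : realType) (F : fieldType) (V : pmod R F) (s t u : R)
    (hst : s <= t) (htu : t <= u) (hsu : s <= u) (x : V s) :
  inner V hst x = 0 -> inner V hsu x = 0.
Proof. by move=> x0; rewrite -(inner_comp hst htu) x0 linear0. Qed.

Lemma bprec_count_ElR (R : realType) (J1 J2 : bar R) (D : seq (elementary R)) :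
  (0 < count (is_ElR J1 J2) D)%N -> bprec J1 J2.
Proof.
elim: D => [//|[K1 K2 h|J|K] D IH] //=.
by case: andP => [[/eqP <- /eqP <-] _|_ /IH].
Qed.

(** * Transfer of multiplicities from [Phi] to [Psi] *)

Section Transfer.
Variables (R : realType) (F : fieldType) (V W : pmod R F).
Variables (delta : R) (hdelta : 0 <= delta).
Variables (Phi : pmor V (shift W delta)) (Psi : pmor W (shift V delta)).
Hypothesis hPhiPsi : interleaving hdelta Phi Psi.
Variables (BV : seq (bar R)) (JV JW : bar R).
Hypotheses (hBV : is_barcode V BV) (hXi : ((2 * delta)%:E < nestedness BV)%E).
Hypotheses (hJV : JV \in BV).
Hypotheses (hlenV : 2 * delta <= blen JV) (hlenW : 2 * delta <= blen JW).

Lemma count_ElR_le (DPhi DPsi : seq (elementary R)) :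
  ladder_decomposition Phi DPhi -> ladder_decomposition Psi DPsi ->
  (count (is_ElR (bshift JW delta) JV) DPhi <=
   count (is_ElR (bshift JV delta) JW) DPsi)%N.
Proof.
move=> hDPhi hDPsi.
move: (has_retraction_decomposition (bshift JW delta) JV hDPhi).
move: (hlenV) (hlenW) (hdelta); rewrite /blen => lenV lenW delta_ge0.
have [-> //|] := posnP (count (is_ElR (bshift JW delta) JV) DPhi).
move=> n_gt0; have /and3P[ac cb bd] := bprec_count_ElR n_gt0.
move: (count _ DPhi) n_gt0 => n n_gt0 [E [G [P [Q r]]]].
have {}ac : lo JW - delta <= lo JV by [].
have {}cb : lo JV <= hi JW - delta by [].
have {}bd : hi JW - delta <= hi JV by [].
have [PsiPhi PhiPsi] := hPhiPsi.
(* Contradictions below take the form that all coordinate vectors vanish, which is impossible for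
   positive [n]. *)
have no_zero : ~ forall x : 'rV[F]_n, x = 0.
  move/(_ (const_mx 1))/rowP/(_ (Ordinal n_gt0)); rewrite !mxE => /eqP.
  by rewrite oner_eq0.
(* The generators [G x] live at index [lo JW - delta + delta], which equals [lo JW] only up to a
   proof; [g] moves them there. *)
have ha : lo JW - delta + delta <= lo JW by rewrite subrK.
pose g x := inner W ha (G x).
have lin_g : linear g by move=> k x y; rewrite /g (retr_linG r) linearP.
have g_dies u (h : lo JW <= u) x : hi JW < u -> inner W h (g x) = 0.
  move=> hu; have h1 : lo JW - delta <= u - delta by lra.
  have h2 : lo JW - delta + delta <= u - delta + delta by lra.
  have h3 : u - delta + delta <= u by lra.
  have h4 : lo JW - delta + delta <= u by lra.
  rewrite /g (inner_comp _ _ h4) -(inner_comp h2 h3) -inner_shift.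
  rewrite (retr_Gdies r) ?linear0 //.
  by rewrite -[hi (bshift _ _)]/(hi JW - delta); lra.
have Psi_g x (h1 : lo JW + delta <= lo JV + delta + delta) (h2 : lo JV <= lo JV + delta + delta) :
    inner V h1 (Psi _ (g x)) = inner V h2 (E x).
  have h3 : lo JW <= lo JV + delta by lra.
  have h4 : lo JW - delta + delta <= lo JV + delta by lra.
  rewrite -(inner_shift h3) -pm_natural /g (inner_comp _ _ h4).
  rewrite -(inner_shift ac) -(retr_gen r ac) PsiPhi.
  by rewrite (bool_irrelevance (le_add2 _ _) h2).
have hac2 : lo JW + delta <= lo JV + delta + delta by lra.
have hcc2 : lo JV <= lo JV + delta + delta by lra.
(* Otherwise [E x], still alive at [lo JV + 2 delta] because [JV] has length at least [2 delta],
   would come from an index before [lo JV], so [P] would give both [x] and 0. *)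
have ca : lo JV <= lo JW + delta.
  rewrite leNgt; apply/negP => lt; apply: no_zero => x.
  have h : lo JV + delta + delta <= hi JV by lra.
  by rewrite -(retr_PE r hcc2 x h) -(Psi_g _ hac2) (retr_Pborn r).
have had : lo JW + delta <= hi JV by lra.
have hcd : lo JV <= hi JV by exact: lo_le_hi.
have h2d : lo JV + delta + delta <= hi JV by lra.
(* Otherwise the path of [g x] to index [hi JV] in [V] can pass through [W] at [hi JV - delta],
   after the death of [JW], although [E x] is alive at [hi JV]. *)
have db : hi JV <= hi JW + delta.
  rewrite leNgt; apply/negP => lt; apply: no_zero => x.
  rewrite -(retr_PE r hcd x (lexx _)) -(inner_comp hcc2 h2d) -(Psi_g _ hac2).
  have h1 : lo JW <= hi JV - delta by lra.
  have h2 : lo JW + delta <= hi JV - delta + delta by lra.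
  have h3 : hi JV - delta + delta <= hi JV by lra.
  rewrite (inner_comp _ _ had) -(inner_comp h2 h3) -(inner_shift h1) -pm_natural.
  rewrite g_dies ?linear0; last by lra.
  by apply: linear_at0; exact: (retr_linP r).
have prec : bprec (bshift JV delta) JW.
  change [&& lo JV - delta <= lo JW, lo JW <= hi JV - delta & hi JV - delta <= hi JW].
  by apply/and3P; split; lra.
pose z x : V (lo JW + delta) := Psi _ (g x) - inner V ca (E x).
have zE x : Psi _ (g x) = inner V ca (E x) + z x by rewrite addrC subrK.
have z_dies x : inner V hac2 (z x) = 0.
  by rewrite linearB (Psi_g _ _ hcc2) (inner_comp _ _ hcc2) subrr.
have z_dies_d x : inner V had (z x) = 0 by exact: (@inner_eq0 _ _ V _ _ _ hac2).
(* A bar of [V] alive at [lo JW + delta] and dead before [lo JV + 2 delta] but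
   born after [lo JV] would be nested in [JV] with a gap of at most [2 delta]. *)
have z_born x : exists y, z x = inner V ca y.
  apply: barcode_ker_sub_im hBV _ (z_dies x) => K KB l u lt.
  rewrite leNgt; apply/negP => late.
  have nest : bnested K JV by rewrite /bnested late; apply: lt_le_trans h2d.
  have := nestedness_gt hXi KB hJV nest.
  by rewrite gtr0_norm ?subr_gt0 //; lra.
(* Pair the vectors [g x] with the coordinates of [Psi y] on the generators [E]; the resulting
   matrix is the identity, of rank [n]. *)
have := mult_le_decomposition prec hDPsi.
move=> /(_ n n g (fun y => P _ (Psi _ y)) 1%:M lin_g).
rewrite mxrank1; apply.
- by move=> k x y; rewrite linearP (retr_linP r).
- move=> x; split.
  + by move=> t h; exact: g_dies.
  + move=> h; have [y zy] := z_born x.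
    have h1 : lo JV <= lo JV - delta + delta by lra.
    have h2 : lo JV - delta + delta <= lo JW + delta by lra.
    exists (inner V h1 (E x + y)).
    rewrite (inner_shift h h2) (inner_comp h1 h2 ca) linearD -zy.
    exact: zE.
  + move=> t h; rewrite -[hi (bshift _ _)]/(hi JV - delta) => ht.
    have h1 : lo JW + delta <= t + delta by lra.
    have h2 : lo JV <= t + delta by lra.
    have h3 : hi JV <= t + delta by lra.
    have hVt : hi JV < t + delta by lra.
    rewrite (inner_shift h h1) [lmor _ _ _]zE linearD (inner_comp _ _ h2).
    by rewrite (retr_Edies r) // (inner_eq0 h3 _ (z_dies_d x)) addr0.
(* The bound [hb], due to the length of [JW], makes [retr_QP] available at [lo JW + delta]. The two
   domain conditions are then checked on [Q (Phi (Psi y))], where [Phi (Psi y)] is an inner map of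
   [W] applied to [y]; the two codomain conditions are checked directly on [P (Psi y)]. *)
- have hb : lo JW + delta <= hi JW - delta by lra.
  split.
  + move=> s h y hs; rewrite -(retr_QP r) // [lmor _ _ _]PhiPsi.
    have h1 : s <= s - delta + delta by lra.
    have h2 : s - delta <= lo JW + delta by lra.
    have h3 : s - delta + delta <= lo JW + delta + delta by lra.
    have h4 : s <= lo JW + delta + delta by lra.
    rewrite (inner_comp _ _ h4) -(inner_comp h1 h3) -(inner_shift h2).
    rewrite (retr_Qborn r) //.
    by rewrite -[lo (bshift _ _)]/(lo JW - delta); lra.
  + move=> y y0; rewrite -(retr_QP r) // [lmor _ _ _]PhiPsi.
    apply: (retr_Qker r (h := hb)).
    have h1 : lo JW + delta + delta <= hi JW - delta + delta by lra.
    have h2 : lo JW <= hi JW - delta + delta by lra.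
    have h3 : hi JW <= hi JW - delta + delta by lra.
    by rewrite (inner_shift hb h1) (inner_comp _ _ h2) (inner_eq0 h3 _ y0).
  + move=> y s h x; rewrite -[lo (bshift _ _)]/(lo JV - delta) => hs /= ->.
    by rewrite (retr_Pborn r) //; lra.
  + move=> y h y0; apply: (retr_Pker r (h := had)).
    have h2 : lo JW + delta <= hi JV - delta + delta by lra.
    have h3 : hi JV - delta + delta <= hi JV by lra.
    by apply: (@inner_eq0 _ _ V _ _ _ h2 h3 had); rewrite -(inner_shift h h2).
(* The error term [z x] dies by [hi JV], so [P] does not see it and returns the coordinates [x] of
   [E x]. *)
- move=> x; rewrite mulmx1 zE.
  have := retr_linP r 1 (inner V ca (E x)) (z x); rewrite !scale1r => ->.
  by rewrite (retr_PE r) // (retr_Pker r (z_dies_d x)) addr0.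
Qed.

End Transfer.

Theorem theorem3p23 (R : realType) (F : fieldType) (V W : pmod R F)
  (BV BW : seq (bar R)) (hBV : is_barcode V BV) (hBW : is_barcode W BW)
  (delta : R) (hdelta : 0 <= delta)
  (hXi : (delta%:E < (2^-1)%:E * Order.min (nestedness BV) (nestedness BW))%E)
  (Phi : pmor V (shift W delta)) (Psi : pmor W (shift V delta))
  (hPhiPsi : interleaving hdelta Phi Psi)
  (DPhi DPsi : seq (elementary R))
  (hDPhi : ladder_decomposition Phi DPhi)
  (hDPsi : ladder_decomposition Psi DPsi)
  (JV JW : bar R) (hJV : JV \in BV) (hJW : JW \in BW)
  (hlenV : 2 * delta <= blen JV) (hlenW : 2 * delta <= blen JW)
  (mu : nat) :
  appears_R DPhi (bshift JW delta) JV mu <-> appears_R DPsi (bshift JV delta) JW mu.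
Proof.
(* Clearing the factor one half needs a case split, since the minimum may be infinite. *)
have : ((2 * delta)%:E < Order.min (nestedness BV) (nestedness BW))%E.
  move: hXi; case: (Order.min _ _) => [x| |].
  - by rewrite -EFinM !lte_fin => h; lra.
  - by rewrite ltry.
  - by rewrite gt0_muleNy ?lte_fin ?invr_gt0.
rewrite lt_min => /andP[XiV XiW].
(* Interleaving is symmetric in the two modules, so the same lemma yields the reverse inequality. *)
have hPsiPhi : interleaving hdelta Psi Phi by have [? ?] := hPhiPsi.
suff -> : appears_R DPhi (bshift JW delta) JV mu = appears_R DPsi (bshift JV delta) JW mu by [].
congr (_ = mu); apply/eqP; rewrite eqn_leq.
rewrite (count_ElR_le hPhiPsi hBV XiV hJV hlenV hlenW hDPhi hDPsi).
exact: (count_ElR_le hPsiPhi hBW XiW hJW hlenW hlenV hDPsi hDPhi).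
Qed.
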